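(* Let $T$ be a recursively enumerable extension of $\mathsf{PA}_\Box$. (1) If $T$ contains $\mathsf{PA}(\mathsf{K})$, $T\nvdash\Box\bot$, and $T$ has $\Sigma_1(\Box)$-DP, then $T$ is weakly $\Sigma_1(\Box)$-sound. (2) If $T$ is weakly $\Sigma_1(\Box)$-sound, then $T$ has $\Sigma_1(\Box)$-EP.
   Context: $\mathcal{L}_A(\Box)$ is the language of arithmetic $\mathcal{L}_A=\{0,S,+,\times,\le,=\}$ plus a unary modal operator $\Box$; derivations use modus ponens, generalization and necessitation (from $\varphi$ infer $\Box\varphi$). $\mathsf{PA}_\Box$ is Peano arithmetic plus first-order logical axioms for $\mathcal{L}_A(\Box)$-formulas (including universal instantiation for $\mathcal{L}_A$-terms) and induction for all $\mathcal{L}_A(\Box)$-formulas; $\mathsf{PA}(\mathsf{K})$ adds universal closures of all $\Box(\varphi\to\psi)\to(\Box\varphi\to\Box\psi)$. $\Sigma_1(\Box)$ is the smallest class containing arithmetic $\Sigma_1$ formulas and all $\Box\varphi$, closed under $\land,\lor,\exists x,\forall x<t$ ($t$ an $\mathcal{L}_A$-term not containing $x$). $T$ has $\Sigma_1(\Box)$-DP if for $\Sigma_1(\Box)$ sentences $\varphi,\psi$, $T\vdash\varphi\lor\psi$ implies $T\vdash\varphi$ or $T\vdash\psi$; $T$ has $\Sigma_1(\Box)$-EP if for every $\Sigma_1(\Box)$ formula $\varphi(x)$ with no free variables other than $x$, $T\vdash\exists x\varphi(x)$ implies $T\vdash\varphi(\overline n)$ for some natural number $n$. $\mathrm{Pr}_T(x)$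 is a fixed natural $\Sigma_1$ provability predicate of $T$; the translation $\rho_T$ into $\mathcal{L}_A$ is the identity on $\mathcal{L}_A$-formulas, commutes with connectives and quantifiers, and sets $\rho_T(\Box\psi(\vec x)):=\mathrm{Pr}_T(\ulcorner\Box\psi(\vec{\dot x})\urcorner)$ (with $\ulcorner\Box\psi(\vec{\dot x})\urcorner$ a primitive recursive term for the code of $\Box\psi(\vec{\overline n})$). $T$ is weakly $\Sigma_1(\Box)$-sound if for every $\Sigma_1(\Box)$ sentence $\varphi$, $T\vdash\varphi$ implies $\mathbb{N}\models\rho_T(\varphi)$. *)

(* Defs.v *)
From mathcomp Require Import all_boot.

Set Implicit Arguments.
Unset Strict Implicit.
Unset Printing Implicit Defensive.

(** Syntax.  Variables are de Bruijn indices: [All A], [Ex A] bind index 0 of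
    [A], and index [i] at depth [d <= i] denotes the free variable [i - d]. *)

Inductive term : Type :=
| Var of nat
| Zero
| Succ of term
| Add of term & term
| Mul of term & term.

Inductive form : Type :=
| Eq of term & term
| Le of term & term
| Bot
| Imp of form & form
| And of form & form
| Or of form & form
| All of form
| Ex of form
| Box of form.

Definition Neg (A : form) : form := Imp A Bot.
Definition Iff (A B : form) : form := And (Imp A B) (Imp B A).
Definition Lt (s t : term) : form := Le (Succ s) t.

Definition numeral (n : nat) : term := iter n Succ Zero.

Fixpoint tsubst (s : nat -> term) (t : term) : term :=
  match t with
  | Var i => s i
  | Zero => Zero
  | Succ u => Succ (tsubst s u)
  | Add u v => Add (tsubst s u) (tsubst s v)
  | Mul u v => Mul (tsubst s u) (tsubst s v)
  end.

Definition tshift (t : term) : term := tsubst (fun i => Var i.+1) t.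

Definition scons {X : Type} (x : X) (s : nat -> X) (i : nat) : X :=
  if i is j.+1 then s j else x.

Definition up (s : nat -> term) : nat -> term :=
  scons (Var 0) (fun i => tshift (s i)).

Fixpoint subst (s : nat -> term) (A : form) : form :=
  match A with
  | Eq u v => Eq (tsubst s u) (tsubst s v)
  | Le u v => Le (tsubst s u) (tsubst s v)
  | Bot => Bot
  | Imp B C => Imp (subst s B) (subst s C)
  | And B C => And (subst s B) (subst s C)
  | Or B C => Or (subst s B) (subst s C)
  | All B => All (subst (up s) B)
  | Ex B => Ex (subst (up s) B)
  | Box B => Box (subst s B)
  end.

Definition shift (A : form) : form := subst (fun i => Var i.+1) A.

(** [inst A t] is A(t) for A = A(x), where x is index 0. *)
Definition inst (A : form) (t : term) : form := subst (scons t Var) A.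

(** [bounded n A]: the free variables of [A] are among the indices below [n]. *)
Fixpoint tbounded (n : nat) (t : term) : bool :=
  match t with
  | Var i => i < n
  | Zero => true
  | Succ u => tbounded n u
  | Add u v | Mul u v => tbounded n u && tbounded n v
  end.

Fixpoint bounded (n : nat) (A : form) : bool :=
  match A with
  | Eq u v | Le u v => tbounded n u && tbounded n v
  | Bot => true
  | Imp B C | And B C | Or B C => bounded n B && bounded n C
  | All B | Ex B => bounded n.+1 B
  | Box B => bounded n B
  end.

Definition sentence (A : form) : bool := bounded 0 A.

(** The formulas of the language of arithmetic. *)
Fixpoint arithmetical (A : form) : bool :=
  match A with
  | Eq _ _ | Le _ _ | Bot => true
  | Imp B C | And B C | Or B C => arithmetical B && arithmetical C
  | All B | Ex B => arithmetical B
  | Box _ => false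
  end.

(** Bounded quantifiers; the shift of the bound says that it does not contain
    the quantified variable. *)
Definition AllLt (t : term) (A : form) : form :=
  All (Imp (Lt (Var 0) (tshift t)) A).
Definition ExLt (t : term) (A : form) : form :=
  Ex (And (Lt (Var 0) (tshift t)) A).

Inductive delta0 : form -> Prop :=
| delta0_Eq s t : delta0 (Eq s t)
| delta0_Le s t : delta0 (Le s t)
| delta0_Bot : delta0 Bot
| delta0_Imp A B : delta0 A -> delta0 B -> delta0 (Imp A B)
| delta0_And A B : delta0 A -> delta0 B -> delta0 (And A B)
| delta0_Or A B : delta0 A -> delta0 B -> delta0 (Or A B)
| delta0_AllLt t A : delta0 A -> delta0 (AllLt t A)
| delta0_ExLt t A : delta0 A -> delta0 (ExLt t A).

Inductive sigma1 : form -> Prop :=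
| sigma1_delta0 A : delta0 A -> sigma1 A
| sigma1_Ex A : sigma1 A -> sigma1 (Ex A).

Inductive sigma1Box : form -> Prop :=
| sigma1Box_sigma1 A : sigma1 A -> sigma1Box A
| sigma1Box_Box A : sigma1Box (Box A)
| sigma1Box_And A B : sigma1Box A -> sigma1Box B -> sigma1Box (And A B)
| sigma1Box_Or A B : sigma1Box A -> sigma1Box B -> sigma1Box (Or A B)
| sigma1Box_Ex A : sigma1Box A -> sigma1Box (Ex A)
| sigma1Box_AllLt t A : sigma1Box A -> sigma1Box (AllLt t A).

(** Hilbert-style classical first-order logic with equality; all schemes range
    over formulas with [Box]. *)
Inductive logical_axiom : form -> Prop :=
| ax_K A B : logical_axiom (Imp A (Imp B A))
| ax_S A B C : logical_axiom
    (Imp (Imp A (Imp B C)) (Imp (Imp A B) (Imp A C)))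
| ax_DN A : logical_axiom (Imp (Neg (Neg A)) A)
| ax_AndI A B : logical_axiom (Imp A (Imp B (And A B)))
| ax_AndE1 A B : logical_axiom (Imp (And A B) A)
| ax_AndE2 A B : logical_axiom (Imp (And A B) B)
| ax_OrI1 A B : logical_axiom (Imp A (Or A B))
| ax_OrI2 A B : logical_axiom (Imp B (Or A B))
| ax_OrE A B C : logical_axiom
    (Imp (Imp A C) (Imp (Imp B C) (Imp (Or A B) C)))
| ax_AllE A t : logical_axiom (Imp (All A) (inst A t))
| ax_AllI A B : logical_axiom (Imp (All (Imp (shift A) B)) (Imp A (All B)))
| ax_ExI A t : logical_axiom (Imp (inst A t) (Ex A))
| ax_ExE A B : logical_axiom (Imp (All (Imp A (shift B))) (Imp (Ex A) B))
| ax_EqRefl t : logical_axiom (Eq t t)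
| ax_EqSubst A s t : logical_axiom (Imp (Eq s t) (Imp (inst A s) (inst A t))).

(** A theory is given by its nonlogical axioms. *)
Definition theory := form -> Prop.

Inductive proves (T : theory) : form -> Prop :=
| pr_logical A : logical_axiom A -> proves T A
| pr_axiom A : T A -> proves T A
| pr_MP A B : proves T (Imp A B) -> proves T A -> proves T B
| pr_Gen A : proves T A -> proves T (All A)
| pr_Nec A : proves T A -> proves T (Box A).

Definition extends (T S : theory) : Prop := forall A, proves S A -> proves T A.

(** The axioms are open formulas, to be read universally closed. *)
Inductive PABox : theory :=
| PA_Succ_neq0 : PABox (Neg (Eq (Succ (Var 0)) Zero))
| PA_Succ_inj : PABox
    (Imp (Eq (Succ (Var 0)) (Succ (Var 1))) (Eq (Var 0) (Var 1)))
| PA_Add0 : PABox (Eq (Add (Var 0) Zero) (Var 0))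
| PA_AddS : PABox
    (Eq (Add (Var 0) (Succ (Var 1))) (Succ (Add (Var 0) (Var 1))))
| PA_Mul0 : PABox (Eq (Mul (Var 0) Zero) Zero)
| PA_MulS : PABox
    (Eq (Mul (Var 0) (Succ (Var 1))) (Add (Mul (Var 0) (Var 1)) (Var 0)))
| PA_Le : PABox
    (Iff (Le (Var 0) (Var 1)) (Ex (Eq (Add (Var 0) (Var 1)) (Var 2))))
| PA_Ind A : PABox
    (Imp (inst A Zero)
      (Imp (All (Imp A (subst (scons (Succ (Var 0)) (fun i => Var i.+1)) A)))
        (All A))).

Definition universal_closure (A C : form) : Prop :=
  sentence C /\ exists n, C = iter n All A.

Inductive PAK : theory :=
| PAK_PABox A : PABox A -> PAK A
| PAK_K A B C :
    universal_closure (Imp (Box (Imp A B)) (Imp (Box A) (Box B))) C -> PAK C.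

Definition has_sigma1Box_DP (T : theory) : Prop :=
  forall A B, sigma1Box A -> sigma1Box B -> sentence A -> sentence B ->
    proves T (Or A B) -> proves T A \/ proves T B.

Definition has_sigma1Box_EP (T : theory) : Prop :=
  forall A, sigma1Box A -> bounded 1 A ->
    proves T (Ex A) -> exists n, proves T (inst A (numeral n)).

(** The standard model. *)
Fixpoint teval (e : nat -> nat) (t : term) : nat :=
  match t with
  | Var i => e i
  | Zero => 0
  | Succ u => (teval e u).+1
  | Add u v => teval e u + teval e v
  | Mul u v => teval e u * teval e v
  end.

(** Meaningful for arithmetical formulas only: the value at [Box] is junk. *)
Fixpoint sat (e : nat -> nat) (A : form) : Prop :=
  match A with
  | Eq u v => teval e u = teval e v
  | Le u v => teval e u <= teval e v
  | Bot => False
  | Imp B C => sat e B -> sat e C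
  | And B C => sat e B /\ sat e C
  | Or B C => sat e B \/ sat e C
  | All B => forall n, sat (scons n e) B
  | Ex B => exists n, sat (scons n e) B
  | Box _ => False
  end.

Definition true_in_N (A : form) : Prop := forall e, sat e A.

(** Gödel numbering.  The pairing (a + b)^2 + a is injective and is given by a
    term.  A term S...S u, with [k] successors and [u] not a successor, is coded
    by the pair of [k] and a code of [u]; hence the code of the numeral of [n]
    is a polynomial in [n]. *)
Definition npair (a b : nat) : nat := (a + b) * (a + b) + a.
Definition tpair (s t : term) : term := Add (Mul (Add s t) (Add s t)) s.

(** [tcode k t] is the code of [iter k Succ t]. *)
Fixpoint tcode (k : nat) (t : term) : nat :=
  match t with
  | Var i => npair k (npair 0 i)
  | Zero => npair k (npair 1 0)
  | Succ u => tcode k.+1 u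
  | Add u v => npair k (npair 2 (npair (tcode 0 u) (tcode 0 v)))
  | Mul u v => npair k (npair 3 (npair (tcode 0 u) (tcode 0 v)))
  end.

Fixpoint code (A : form) : nat :=
  match A with
  | Eq u v => npair 0 (npair (tcode 0 u) (tcode 0 v))
  | Le u v => npair 1 (npair (tcode 0 u) (tcode 0 v))
  | Bot => npair 2 0
  | Imp B C => npair 3 (npair (code B) (code C))
  | And B C => npair 4 (npair (code B) (code C))
  | Or B C => npair 5 (npair (code B) (code C))
  | All B => npair 6 (code B)
  | Ex B => npair 7 (code B)
  | Box B => npair 8 (code B)
  end.

(** [dot 0 A] is the term, in the free variables of [A], whose value at [e] is
    the code of A with the numeral of [e i] put for each free variable [i] (see
    [dot_spec]); [d] counts the binders passed, and [k] is a term for the number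
    of successors passed. *)
Fixpoint tdot (d : nat) (k t : term) : term :=
  match t with
  | Var i => if i < d then tpair k (numeral (npair 0 i))
             else tpair (Add k (Var (i - d))) (numeral (npair 1 0))
  | Zero => tpair k (numeral (npair 1 0))
  | Succ u => tdot d (Succ k) u
  | Add u v => tpair k (tpair (numeral 2) (tpair (tdot d Zero u) (tdot d Zero v)))
  | Mul u v => tpair k (tpair (numeral 3) (tpair (tdot d Zero u) (tdot d Zero v)))
  end.

Fixpoint dot (d : nat) (A : form) : term :=
  match A with
  | Eq u v => tpair (numeral 0) (tpair (tdot d Zero u) (tdot d Zero v))
  | Le u v => tpair (numeral 1) (tpair (tdot d Zero u) (tdot d Zero v))
  | Bot => tpair (numeral 2) (numeral 0)
  | Imp B C => tpair (numeral 3) (tpair (dot d B) (dot d C))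
  | And B C => tpair (numeral 4) (tpair (dot d B) (dot d C))
  | Or B C => tpair (numeral 5) (tpair (dot d B) (dot d C))
  | All B => tpair (numeral 6) (dot d.+1 B)
  | Ex B => tpair (numeral 7) (dot d.+1 B)
  | Box B => tpair (numeral 8) (dot d B)
  end.

Lemma npair_inj a b a' b' : npair a b = npair a' b' -> a = a' /\ b = b'.
Proof.
rewrite /npair => E; have Es : a + b = a' + b'.
  have aux x y x' y' : x + y < x' + y' ->
      (x + y) * (x + y) + x < (x' + y') * (x' + y') + x'.
    move=> lt; apply: leq_trans (leq_addr _ _); apply: leq_trans (leq_mul lt lt).
    rewrite mulnS mulSn -addnS addnC; apply: leq_add; last exact: leq_addl.
    by rewrite ltnS leq_addr.
  by case: (ltngtP (a + b) (a' + b')) => // /aux; rewrite E ltnn.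
by move: E; rewrite Es => /addnI Ea; move: Es; rewrite Ea => /addnI.
Qed.

Lemma tcode_inj k t k' t' :
  tcode k t = tcode k' t' -> iter k Succ t = iter k' Succ t'.
Proof.
elim: t k k' t' => [i||u IHu|u IHu v IHv|u IHu v IHv] k k' t' /=;
  try (by rewrite -iterSr; exact: IHu);
  elim: t' k' => [j||w IHw|w _ z _|w _ z _] k' /=;
  try (by move/IHw; rewrite -iterSr);
  case/npair_inj=> -> /npair_inj [] //.
- by move=> _ ->.
- by move=> _ /npair_inj [/IHu /= -> /IHv /= ->].
- by move=> _ /npair_inj [/IHu /= -> /IHv /= ->].
Qed.

Lemma code_inj : injective code.
Proof.
have tc u v : tcode 0 u = tcode 0 v -> u = v by move/tcode_inj.
elim=> [u v|u v||A IA B IB|A IA B IB|A IA B IB|A IA|A IA|A IA];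
  case=> [u' v'|u' v'||A' B'|A' B'|A' B'|A'|A'|A'] /= /npair_inj [] //= _;
  try (by case/npair_inj=> /tc -> /tc ->);
  try (by case/npair_inj=> /IA -> /IB ->);
  by move/IA->.
Qed.

Lemma teval_numeral e n : teval e (numeral n) = n.
Proof. by elim: n => //= n ->. Qed.

Lemma tdot_spec e d k t :
  teval e (tdot d k t) =
  tcode (teval e k) (tsubst (iter d up (fun i => numeral (e i))) t).
Proof.
have num m n : tcode m (numeral n) = npair (m + n) (npair 1 0).
  by elim: n m => [|n IH] m /=; rewrite ?addn0 // IH addSnnS.
have shn n : tshift (numeral n) = numeral n.
  by elim: n => //= n IH; rewrite /tshift /= -/(tshift _) IH.
have ups d' i : iter d' up (fun i => numeral (e i)) i =
    if i < d' then Var i else numeral (e (i - d')).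
  elim: d' i => [|d' IH] [|i] //=.
  by rewrite IH ltnS subSS; case: ifP.
elim: t k => [i||u IHu|u IHu v IHv|u IHu v IHv] k /=.
- by rewrite ups; case: ifP => _; rewrite ?num /tpair /npair /= ?teval_numeral.
- by rewrite /tpair /npair.
- by rewrite IHu.
- by rewrite IHu IHv.
- by rewrite IHu IHv.
Qed.

Lemma dot_spec e A :
  teval e (dot 0 A) = code (subst (fun i => numeral (e i)) A).
Proof.
rewrite -[fun i => numeral _]/(iter 0 up (fun i => numeral (e i))).
elim: A 0 => [u v|u v||A IA B IB|A IA B IB|A IA B IB|A IA|A IA|A IA] d /=;
  rewrite ?tdot_spec ?IA ?IB //.
Qed.

(** The translation, for Pr = Pr(x) with x the index 0. *)
Fixpoint rho (Pr : form) (A : form) : form :=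
  match A with
  | Eq u v => Eq u v
  | Le u v => Le u v
  | Bot => Bot
  | Imp B C => Imp (rho Pr B) (rho Pr C)
  | And B C => And (rho Pr B) (rho Pr C)
  | Or B C => Or (rho Pr B) (rho Pr C)
  | All B => All (rho Pr B)
  | Ex B => Ex (rho Pr B)
  | Box B => inst Pr (dot 0 (Box B))
  end.

(** [rho] never produces the junk case of [sat]. *)
Lemma arithmetical_rho Pr A : arithmetical Pr -> arithmetical (rho Pr A).
Proof.
move=> hPr; have sub B s : arithmetical (subst s B) = arithmetical B.
  by elim: B s => //= [B IB C IC|B IB C IC|B IB C IC] s; rewrite IB IC.
elim: A => //= [A -> B ->|A -> B ->|A -> B ->|A _] //.
by rewrite /inst sub.
Qed.

(** [Pr] is a Sigma_1 formula expressing provability in [T]. *)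
Definition provability_predicate (T : theory) (Pr : form) : Prop :=
  [/\ sigma1 Pr, bounded 1 Pr &
      forall A, sentence A ->
        (true_in_N (inst Pr (numeral (code A))) <-> proves T A)].

Definition weakly_sigma1Box_sound (T : theory) (Pr : form) : Prop :=
  forall A, sigma1Box A -> sentence A -> proves T A -> true_in_N (rho Pr A).

(** Partial recursive functions.  Arguments are given as a list; a missing
    argument of [rf_succ] or [rf_proj] counts as 0. *)
Inductive recfun : Type :=
| rf_zero
| rf_succ
| rf_proj of nat
| rf_comp of recfun & seq recfun
| rf_rec of recfun & recfun
| rf_mu of recfun.

Inductive computes : recfun -> seq nat -> nat -> Prop :=
| computes_zero xs : computes rf_zero xs 0
| computes_succ xs : computes rf_succ xs (head 0 xs).+1
| computes_proj i xs : computes (rf_proj i) xs (nth 0 xs i)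
| computes_comp f gs xs ys y :
    computes_seq gs xs ys -> computes f ys y -> computes (rf_comp f gs) xs y
| computes_rec0 f g xs y :
    computes f xs y -> computes (rf_rec f g) (0 :: xs) y
| computes_recS f g n xs z y :
    computes (rf_rec f g) (n :: xs) z -> computes g [:: n, z & xs] y ->
    computes (rf_rec f g) (n.+1 :: xs) y
| computes_mu f xs n :
    computes f (n :: xs) 0 ->
    (forall m, m < n -> exists y, computes f (m :: xs) y.+1) ->
    computes (rf_mu f) xs n
with computes_seq : seq recfun -> seq nat -> seq nat -> Prop :=
| computes_nil xs : computes_seq [::] xs [::]
| computes_cons f fs xs y ys :
    computes f xs y -> computes_seq fs xs ys ->
    computes_seq (f :: fs) xs (y :: ys).

Definition recursively_enumerable (P : nat -> Prop) : Prop :=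
  exists f, forall n, P n <-> exists y, computes f [:: n] y.

Definition re_theory (T : theory) : Prop :=
  recursively_enumerable (fun n => exists2 A, T A & n = code A).

(* Main.v *)
(** Completeness: a sigma1Box sentence whose translation is true is provable,
    since a true [rho (Box B)] just says that [Box B] is provable.  This gives
    (2).  For (1) one reads a proof of a sigma1Box sentence downwards; the
    disjunction property handles [Or], and the only problem is to extract from
    [T |- Ex x. A] a provable instance.  Let [R(x)] say that below [x] a proof
    of [beta] occurs before any proof of [alpha], where
    [alpha = Ex x. A /\ R(x)] and [beta = Ex x. A /\ ~ R(x)] by
    self-reference.  [T] proves [alpha \/ beta], hence one of them.  If the
    first proof found is one of [alpha], then [R] is refutable, and so is
    [alpha].  If it is one of [beta], then [R(x)] is provable for all large [x],
    so [beta] gives [A(0) \/ ... \/ A(w)], to which the disjunction property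
    applies.  The coding makes the self-reference cheap: the code of
    [Ex v. v = n /\ B] is a polynomial in [n] and the code of [B]. *)

Require Import Defs.
From mathcomp Require Import all_boot.

Set Implicit Arguments.
Unset Strict Implicit.
Unset Printing Implicit Defensive.

(** * Calculus of substitutions and of bounds on free variables *)

Lemma tsubst_ext s s' t : s =1 s' -> tsubst s t = tsubst s' t.
Proof. by move=> E; elim: t => //= [u ->|u -> v ->|u -> v ->]. Qed.

Lemma tsubst_comp s s' t :
  tsubst s (tsubst s' t) = tsubst (fun i => tsubst s (s' i)) t.
Proof. by elim: t => //= [u ->|u -> v ->|u -> v ->]. Qed.

Lemma tsubst_id t : tsubst Var t = t.
Proof. by elim: t => //= [u ->|u -> v ->|u -> v ->]. Qed.

Lemma tshift_up s t : tsubst (up s) (tshift t) = tshift (tsubst s t).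
Proof. by rewrite /tshift !tsubst_comp. Qed.

Lemma up_ext s s' : s =1 s' -> up s =1 up s'.
Proof. by move=> E [|i] //=; rewrite E. Qed.

Lemma up_comp s s' i :
  tsubst (up s) (up s' i) = up (fun j => tsubst s (s' j)) i.
Proof. by case: i => //= i; rewrite tshift_up. Qed.

Lemma up_id : up Var =1 Var.
Proof. by case. Qed.

Lemma subst_ext s s' A : s =1 s' -> subst s A = subst s' A.
Proof.
elim: A s s' => /= [u v|u v||A IA B IB|A IA B IB|A IA B IB|A IA|A IA|A IA]
  s s' E //; rewrite ?(tsubst_ext _ E) ?(IA _ _ E) ?(IB _ _ E) //;
  by rewrite (IA _ _ (up_ext E)).
Qed.

Lemma subst_comp s s' A :
  subst s (subst s' A) = subst (fun i => tsubst s (s' i)) A.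
Proof.
elim: A s s' => /= [u v|u v||A IA B IB|A IA B IB|A IA B IB|A IA|A IA|A IA]
  s s' //; rewrite ?tsubst_comp ?IA ?IB //;
  by rewrite (subst_ext _ (up_comp s s')).
Qed.

Lemma subst_id A : subst Var A = A.
Proof.
elim: A => /= [u v|u v||A IA B IB|A IA B IB|A IA B IB|A IA|A IA|A IA] //;
  by rewrite ?tsubst_id ?(subst_ext _ up_id) ?IA ?IB.
Qed.

Lemma tsubst_shift t u : tsubst (scons u Var) (tshift t) = t.
Proof. by rewrite /tshift tsubst_comp tsubst_id. Qed.

Lemma inst_up s A t : inst (subst (up s) A) t = subst (scons t s) A.
Proof.
rewrite /inst subst_comp; apply: subst_ext => -[|i] //=.
by rewrite tsubst_shift.
Qed.

Lemma tsubst_bounded n s s' t : tbounded n t ->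
  (forall i, i < n -> s i = s' i) -> tsubst s t = tsubst s' t.
Proof.
move=> b E; elim: t b => /= [i|//|u IH|u IHu v IHv|u IHu v IHv];
  [by move/E|by move/IH->| |]; by case/andP=> /IHu -> /IHv ->.
Qed.

Lemma subst_bounded n s s' A : bounded n A ->
  (forall i, i < n -> s i = s' i) -> subst s A = subst s' A.
Proof.
elim: A n s s' => /= [u v|u v||A IA B IB|A IA B IB|A IA B IB|A IA|A IA|A IA]
  n s s' // => [/andP[bu bv]|/andP[bu bv]|/andP[bA bB]|/andP[bA bB]
  |/andP[bA bB]|bA|bA|bA] E;
  rewrite ?(tsubst_bounded bu E) ?(tsubst_bounded bv E) //;
  try (by rewrite (IA _ _ _ bA E) ?(IB _ _ _ bB E));
  by rewrite (IA _ (up s) (up s') bA) // => -[|i] //= /E ->.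
Qed.

Lemma subst_bounded_id n s A : bounded n A ->
  (forall i, i < n -> s i = Var i) -> subst s A = A.
Proof. by move=> b /(subst_bounded b) ->; rewrite subst_id. Qed.

Lemma tbounded_tsubst m n s t : tbounded n t ->
  (forall i, i < n -> tbounded m (s i)) -> tbounded m (tsubst s t).
Proof.
move=> b H; elim: t b => /= [i|//|u //|u IHu v IHv|u IHu v IHv];
  [by move/H| |]; by case/andP=> /IHu -> /IHv ->.
Qed.

Lemma tbounded_tshift m t : tbounded m t -> tbounded m.+1 (tshift t).
Proof. by move/tbounded_tsubst; apply=> i. Qed.

Lemma tbounded_numeral m n : tbounded m (numeral n).
Proof. by elim: n. Qed.

Lemma bounded_subst m n s A : bounded n A ->
  (forall i, i < n -> tbounded m (s i)) -> bounded m (subst s A).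
Proof.
elim: A n m s => /= [u v|u v||A IA B IB|A IA B IB|A IA B IB|A IA|A IA|A IA]
  n m s // => [/andP[bu bv]|/andP[bu bv]|/andP[bA bB]|/andP[bA bB]
  |/andP[bA bB]|bA|bA|bA] E;
  rewrite ?(tbounded_tsubst bu E) ?(tbounded_tsubst bv E) //;
  try (by rewrite (IA _ _ _ bA E) ?(IB _ _ _ bB E));
  by apply: (IA _ _ _ bA) => -[|i] //= /E /tbounded_tshift.
Qed.

Lemma ex_tbounded t : exists n, tbounded n t.
Proof.
have mono u m n : m <= n -> tbounded m u -> tbounded n u.
  move=> le b; rewrite -[u]tsubst_id; apply: (tbounded_tsubst b) => i /= lt.
  exact: leq_trans lt le.
elim: t => [i||u [n b]|u [n b] v [m c]|u [n b] v [m c]] /=; try by exists 0.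
- by exists i.+1 => /=.
- by exists n.
- by exists (maxn n m); rewrite (mono _ _ _ _ b) ?(mono _ _ _ _ c) ?leq_maxl ?leq_maxr.
- by exists (maxn n m); rewrite (mono _ _ _ _ b) ?(mono _ _ _ _ c) ?leq_maxl ?leq_maxr.
Qed.

(** Every term has finitely many variables, so a uniform bound on the values of [s] suffices. In
    particular, filling all variables with numerals yields a sentence. *)
Lemma bounded_subst_all m s A :
  (forall i, tbounded m (s i)) -> bounded m (subst s A).
Proof.
have tb k r t : (forall i, tbounded k (r i)) -> tbounded k (tsubst r t).
  by case: (ex_tbounded t) => n b H; apply: tbounded_tsubst b _.
elim: A m s => /= [u v|u v||A IA B IB|A IA B IB|A IA B IB|A IA|A IA|A IA]
  m s H //; rewrite ?tb ?IA ?IB //; by case=> //= i; apply: tbounded_tshift.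
Qed.

(** * Evaluation and truth in the standard model *)

Lemma teval_ext e e' t : e =1 e' -> teval e t = teval e' t.
Proof. by move=> E; elim: t => //= [u ->|u -> v ->|u -> v ->]. Qed.

Lemma teval_tsubst e s t : teval e (tsubst s t) = teval (fun i => teval e (s i)) t.
Proof. by elim: t => //= [u ->|u -> v ->|u -> v ->]. Qed.

Lemma teval_tshift e n t : teval (scons n e) (tshift t) = teval e t.
Proof. by rewrite /tshift teval_tsubst. Qed.

Lemma sat_bounded n e e' A : bounded n A -> (forall i, i < n -> e i = e' i) ->
  (sat e A <-> sat e' A).
Proof.
have tb k r r' t : tbounded k t -> (forall i, i < k -> r i = r' i) ->
    teval r t = teval r' t.
  move=> b E; elim: t b => /= [i|//|u IH|u IHu v IHv|u IHu v IHv];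
    [by move/E|by move/IH->| |]; by case/andP=> /IHu -> /IHv ->.
have sc (r r' : nat -> nat) k m : (forall i, i < k -> r i = r' i) ->
    forall i, i < k.+1 -> scons m r i = scons m r' i.
  by move=> E [|i] //= /E.
elim: A n e e' => /= [u v|u v||A IA B IB|A IA B IB|A IA B IB|A IA|A IA|A IA]
  n e e' // => [/andP[bu bv]|/andP[bu bv]|/andP[bA bB]|/andP[bA bB]
  |/andP[bA bB]|bA|bA] E; rewrite ?(tb _ _ _ _ bu E) ?(tb _ _ _ _ bv E) //;
  try (by have := IA _ _ _ bA E; have := IB _ _ _ bB E; tauto); split.
- by move=> H m; case: (IA _ _ _ bA (sc _ _ _ m E)) (H m).
- by move=> H m; case: (IA _ _ _ bA (sc _ _ _ m E)) (H m).
- by case=> m H; exists m; case: (IA _ _ _ bA (sc _ _ _ m E)) H.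
- by case=> m H; exists m; case: (IA _ _ _ bA (sc _ _ _ m E)) H.
Qed.

Lemma sat_ext e e' A : e =1 e' -> (sat e A <-> sat e' A).
Proof.
have sc (r r' : nat -> nat) m : r =1 r' -> scons m r =1 scons m r'.
  by move=> E [].
elim: A e e' => /= [u v|u v||A IA B IB|A IA B IB|A IA B IB|A IA|A IA|A IA]
  e e' E //; rewrite ?(teval_ext _ E) //;
  try (by have := IA _ _ E; have := IB _ _ E; tauto).
- by split=> H m; case: (IA _ _ (sc _ _ m E)) (H m).
- by split=> -[m H]; exists m; case: (IA _ _ (sc _ _ m E)) H.
Qed.

Lemma teval_up e s n i :
  teval (scons n e) (up s i) = scons n (fun j => teval e (s j)) i.
Proof. by case: i => //= i; rewrite teval_tshift. Qed.

Lemma sat_subst e s A : arithmetical A ->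
  (sat e (subst s A) <-> sat (fun i => teval e (s i)) A).
Proof.
elim: A e s => //= [u v|u v|A IA B IB|A IA B IB|A IA B IB|A IA|A IA] e s;
  rewrite ?teval_tsubst //;
  try (by case/andP=> a b; have := IA e s a; have := IB e s b; tauto).
- move=> a; split=> H n; first by apply/(sat_ext _ (@teval_up e s n))/IA.
  by apply/IA/(sat_ext _ (@teval_up e s n)).
- move=> a; split=> -[n H]; exists n.
    by apply/(sat_ext _ (@teval_up e s n))/IA.
  by apply/IA/(sat_ext _ (@teval_up e s n)).
Qed.

(** * Classes of formulas and their stability under substitution *)

Lemma delta0_arithmetical A : delta0 A -> arithmetical A.
Proof.
by elim=> {A} //= [A B _ -> _ ->|A B _ -> _ ->|A B _ -> _ ->].
Qed.

Lemma sigma1_arithmetical A : sigma1 A -> arithmetical A.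
Proof. by elim=> {A} // A /delta0_arithmetical. Qed.

Lemma rho_arithmetical Pr A : arithmetical A -> rho Pr A = A.
Proof.
elim: A => //= [A IA B IB|A IA B IB|A IA B IB|A IA|A IA];
  by [case/andP=> /IA -> /IB ->|move/IA->].
Qed.

Lemma delta0_subst s A : delta0 A -> delta0 (subst s A).
Proof.
move=> d; elim: d s => {A} /= [u v|u v||A B _ IA _ IB|A B _ IA _ IB
  |A B _ IA _ IB|t A _ IA|t A _ IA] s; try by constructor.
- by rewrite tshift_up; apply: delta0_AllLt.
- by rewrite tshift_up; apply: delta0_ExLt.
Qed.

Lemma sigma1_subst s A : sigma1 A -> sigma1 (subst s A).
Proof.
move=> d; elim: d s => {A} /= [A /delta0_subst d|A _ IA] s.
- exact: sigma1_delta0.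
- exact: sigma1_Ex.
Qed.

Lemma sigma1Box_subst s A : sigma1Box A -> sigma1Box (subst s A).
Proof.
move=> d; elim: d s => {A} /= [A /sigma1_subst d|A|A B _ IA _ IB|A B _ IA _ IB
  |A _ IA|t A _ IA] s; try by constructor.
by rewrite tshift_up; apply: sigma1Box_AllLt.
Qed.

Lemma tshift_numeral n : tshift (numeral n) = numeral n.
Proof. by elim: n => //= n IH; rewrite /tshift /= -/(tshift _) IH. Qed.

Lemma tsubst_numeral s n : tsubst s (numeral n) = numeral n.
Proof. by elim: n => //= n ->. Qed.

Lemma tsubst_iter s k t : tsubst s (iter k Succ t) = iter k Succ (tsubst s t).
Proof. by elim: k => //= k ->. Qed.

(** In [W] the unbounded quantifiers of [A] are bounded by index 0. *)
Lemma sigma1_witness A : sigma1 A -> exists2 W, delta0 W &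
  forall e, sat e A <-> exists z, sat (scons z e) W.
Proof.
elim=> {A} [A d|A s [W d IH]].
  exists (shift A); first exact: delta0_subst.
  move=> e; have eq z : sat (scons z e) (shift A) <-> sat e A.
    by apply: iff_trans (sat_subst _ _ (delta0_arithmetical _)) _.
  by split=> [H|[z /eq //]]; exists 0; apply/eq.
(* Inside both quantifiers index 2 is the new common bound; [r] makes [W] skip it. *)
pose r := scons (Var 0) (scons (Var 1) (fun i => Var i.+3)).
exists (ExLt (Var 0) (ExLt (Var 1) (subst r W))).
  by do 2!apply: delta0_ExLt; apply: delta0_subst.
move=> e; have eq z x y : sat (scons y (scons x (scons z e))) (subst r W) <->
    sat (scons y (scons x e)) W.
  apply: iff_trans (sat_subst _ _ (delta0_arithmetical _)) _ => //.
  by apply: sat_ext => -[|[|i]].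
split=> [[x /IH[y H]]|[z [x [_ [y [_ /eq H]]]]]]; last first.
  by exists x; apply/IH; exists y.
exists (maxn x y).+1, x; split=> /=; first by rewrite ltnS leq_maxl.
by exists y; split; [rewrite /= ltnS leq_maxr|apply/eq].
Qed.

(** Derivability from hypotheses, with the deduction theorem built in; thus
    necessitation is available for theorems of [T] only. *)
Fixpoint ent (T : theory) (G : seq form) (A : form) : Prop :=
  if G is B :: G' then ent T G' (Imp B A) else proves T A.

(** * Natural deduction and equality reasoning *)

Section Deduction.

Variable T : theory.
Implicit Types (G : seq form) (A B C : form) (s t u : term).

Notation "G |- A" := (ent T G A) (at level 70, no associativity).

Lemma ent_thm G A : proves T A -> G |- A.
Proof.
elim: G A => //= B G IH A H; apply: IH.
by apply: pr_MP H; apply/pr_logical/ax_K.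
Qed.

Lemma ent_ax G A : logical_axiom A -> G |- A.
Proof. by move=> H; apply/ent_thm/pr_logical. Qed.

Lemma ent_mp G A B : G |- Imp A B -> G |- A -> G |- B.
Proof.
elim: G A B => /= [|C G IH] A B; first exact: pr_MP.
move=> HAB HA; apply: (IH _ _ _ HA); apply: IH HAB.
exact/ent_ax/ax_S.
Qed.

Lemma ent_weak G A B : G |- A -> (B :: G) |- A.
Proof. by move=> H; apply: ent_mp H; apply/ent_ax/ax_K. Qed.

Lemma ent_hd G A : (A :: G) |- A.
Proof.
change (G |- Imp A A); apply: (@ent_mp G (Imp A (Imp A A))); last exact/ent_ax/ax_K.
by apply: (@ent_mp G (Imp A (Imp (Imp A A) A))); apply/ent_ax; constructor.
Qed.

Lemma ent_ImpI G A B : (A :: G) |- B -> G |- Imp A B.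
Proof. by []. Qed.

Lemma ent_AndI G A B : G |- A -> G |- B -> G |- And A B.
Proof.
by move=> HA; apply: ent_mp; apply: ent_mp HA; apply/ent_ax; constructor.
Qed.

Lemma ent_And1 G A B : G |- And A B -> G |- A.
Proof. by apply: ent_mp; apply/ent_ax; constructor. Qed.

Lemma ent_And2 G A B : G |- And A B -> G |- B.
Proof. by apply: ent_mp; apply/ent_ax; constructor. Qed.

Lemma ent_Or1 G A B : G |- A -> G |- Or A B.
Proof. by apply: ent_mp; apply/ent_ax; constructor. Qed.

Lemma ent_Or2 G A B : G |- B -> G |- Or A B.
Proof. by apply: ent_mp; apply/ent_ax; constructor. Qed.

Lemma ent_OrE G A B C : G |- Or A B -> (A :: G) |- C -> (B :: G) |- C -> G |- C.
Proof.
move=> H HA HB; apply: ent_mp H; apply: ent_mp (ent_ImpI HB).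
by apply: ent_mp (ent_ImpI HA); apply/ent_ax; constructor.
Qed.

Lemma ent_dn G A : (Neg A :: G) |- Bot -> G |- A.
Proof. by move/ent_ImpI; apply: ent_mp; apply/ent_ax; constructor. Qed.

Lemma ent_BotE G A : G |- Bot -> G |- A.
Proof. by move=> H; apply/ent_dn/ent_weak. Qed.

Lemma ent_em G A B : (A :: G) |- B -> (Neg A :: G) |- B -> G |- B.
Proof.
move=> H1 H2; apply: ent_dn; apply: (ent_mp (ent_hd _ _)).
apply: (@ent_mp _ (Neg A)); first exact/ent_weak/ent_ImpI.
apply: ent_ImpI; apply: ent_mp (ent_weak _ (ent_hd _ _)) _.
by apply: ent_mp (ent_hd _ _); do 2!apply: ent_weak; apply: ent_ImpI.
Qed.

Lemma ent_AllI G A : map shift G |- A -> G |- All A.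
Proof.
elim: G A => /= [|B G IH] A; first exact: pr_Gen.
by move/IH; apply: ent_mp; apply/ent_ax; constructor.
Qed.

Lemma ent_AllE G A t : G |- All A -> G |- inst A t.
Proof. by apply: ent_mp; apply/ent_ax; constructor. Qed.

Lemma ent_ExI G A t : G |- inst A t -> G |- Ex A.
Proof. by apply: ent_mp; apply/ent_ax; constructor. Qed.

Lemma ent_ExE G A B :
  G |- Ex A -> (A :: map shift G) |- shift B -> G |- B.
Proof.
move=> H /ent_ImpI/ent_AllI H'; apply: ent_mp H; apply: ent_mp H'.
by apply/ent_ax; constructor.
Qed.

Arguments ent : simpl never.

Lemma ent_refl G t : G |- Eq t t.
Proof. by apply/ent_ax; constructor. Qed.

(** Index 0 of [A] marks the occurrences to rewrite. The congruence lemmas below shift the other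
    subterms, so that instantiation leaves them alone. *)
Lemma ent_rew A G s t : G |- Eq s t -> G |- inst A s -> G |- inst A t.
Proof. by move=> H; apply: ent_mp; apply: ent_mp H; apply/ent_ax; constructor. Qed.

Lemma ent_sym G s t : G |- Eq s t -> G |- Eq t s.
Proof.
move/(@ent_rew (Eq (Var 0) (tshift s))); rewrite /inst /= !tsubst_shift.
by apply; apply: ent_refl.
Qed.

Lemma ent_trans G s t u : G |- Eq s t -> G |- Eq t u -> G |- Eq s u.
Proof.
move=> H /(@ent_rew (Eq (tshift s) (Var 0))); rewrite /inst /= !tsubst_shift.
exact.
Qed.

Lemma ent_Succ G s t : G |- Eq s t -> G |- Eq (Succ s) (Succ t).
Proof.
move/(@ent_rew (Eq (Succ (tshift s)) (Succ (Var 0)))).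
by rewrite /inst /= !tsubst_shift; apply; apply: ent_refl.
Qed.

Lemma ent_Add G s t s' t' :
  G |- Eq s s' -> G |- Eq t t' -> G |- Eq (Add s t) (Add s' t').
Proof.
move=> /(@ent_rew (Eq (Add (tshift s) (tshift t)) (Add (Var 0) (tshift t)))) H1.
move=> /(@ent_rew (Eq (Add (tshift s) (tshift t)) (Add (tshift s') (Var 0)))).
move: H1; rewrite /inst /= !tsubst_shift => H1; apply; apply: H1.
exact: ent_refl.
Qed.

Lemma ent_Mul G s t s' t' :
  G |- Eq s s' -> G |- Eq t t' -> G |- Eq (Mul s t) (Mul s' t').
Proof.
move=> /(@ent_rew (Eq (Mul (tshift s) (tshift t)) (Mul (Var 0) (tshift t)))) H1.
move=> /(@ent_rew (Eq (Mul (tshift s) (tshift t)) (Mul (tshift s') (Var 0)))).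
move: H1; rewrite /inst /= !tsubst_shift => H1; apply; apply: H1.
exact: ent_refl.
Qed.

Lemma ent_Le G s t s' t' :
  G |- Eq s s' -> G |- Eq t t' -> G |- Le s t -> G |- Le s' t'.
Proof.
move=> /(@ent_rew (Le (Var 0) (tshift t))) H1.
move=> /(@ent_rew (Le (tshift s') (Var 0))).
by move: H1; rewrite /inst /= !tsubst_shift => H1 H2 /H1 /H2.
Qed.

(** Indices 0 and 1 are the only free ones in the axioms of [PABox] other than induction, so this
    yields all their instances. *)
Lemma proves_subst2 A s t :
  proves T A -> proves T (subst (scons s (scons t Var)) A).
Proof.
move=> /pr_Gen/pr_Gen/(@ent_AllE [::] _ t)/(@ent_AllE [::] _ s).
by rewrite -/(subst _ A) inst_up.
Qed.

Lemma ent_iter G k s t :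
  G |- Eq s t -> G |- Eq (iter k Succ s) (iter k Succ t).
Proof. by move=> H; elim: k => //= k; apply: ent_Succ. Qed.

(** * Arithmetic of numerals inside [T] *)

Hypothesis HT : extends T PABox.

Lemma ent_PA2 G A s t : PABox A -> G |- subst (scons s (scons t Var)) A.
Proof. by move=> H; apply/ent_thm/proves_subst2/HT/pr_axiom. Qed.

Lemma ent_Succ_neq0 G t A : G |- Eq (Succ t) Zero -> G |- A.
Proof.
move=> H; apply: ent_BotE; apply: ent_mp H.
exact: (ent_PA2 _ t t PA_Succ_neq0).
Qed.

Lemma ent_Succ_inj G s t : G |- Eq (Succ s) (Succ t) -> G |- Eq s t.
Proof. by apply: ent_mp; apply: (ent_PA2 _ s t PA_Succ_inj). Qed.

Lemma ent_iter_inj G k s t :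
  G |- Eq (iter k Succ s) (iter k Succ t) -> G |- Eq s t.
Proof. by elim: k => //= k IH /ent_Succ_inj. Qed.

Lemma ent_AddS G k s t : G |- Eq (Add s (iter k Succ t)) (iter k Succ (Add s t)).
Proof.
elim: k => /= [|k IH]; first exact: ent_refl.
by apply: ent_trans (ent_Succ IH); apply: (ent_PA2 _ s (iter k Succ t) PA_AddS).
Qed.

Lemma ent_Add_numeral G k s : G |- Eq (Add s (numeral k)) (iter k Succ s).
Proof.
apply: (ent_trans (ent_AddS _ _ _ _)); apply: ent_iter.
exact: (ent_PA2 _ s s PA_Add0).
Qed.

Lemma iter_numeral m n : iter m Succ (numeral n) = numeral (m + n).
Proof. by rewrite /numeral iterD. Qed.

Lemma ent_add_numerals G m n :
  G |- Eq (Add (numeral m) (numeral n)) (numeral (m + n)).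
Proof. by rewrite addnC -iter_numeral; apply: ent_Add_numeral. Qed.

Lemma ent_mul_numerals G m n :
  G |- Eq (Mul (numeral m) (numeral n)) (numeral (m * n)).
Proof.
elim: n => [|n IH] /=.
  by rewrite muln0; apply: (ent_PA2 _ (numeral m) Zero PA_Mul0).
apply: (ent_trans (ent_PA2 _ (numeral m) (numeral n) PA_MulS)) => /=.
apply: (ent_trans (ent_Add IH (ent_refl _ _))).
by rewrite mulnSr; apply: ent_add_numerals.
Qed.

Lemma ent_teval G e t :
  G |- Eq (tsubst (fun i => numeral (e i)) t) (numeral (teval e t)).
Proof.
elim: t => [i||u IH|u IHu v IHv|u IHu v IHv] /=; try exact: ent_refl.
- exact: ent_Succ.
- exact: ent_trans (ent_Add IHu IHv) (ent_add_numerals _ _ _).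
- exact: ent_trans (ent_Mul IHu IHv) (ent_mul_numerals _ _ _).
Qed.

Lemma ent_LeE G s t :
  G |- Le s t -> G |- Ex (Eq (Add (Var 0) (tshift s)) (tshift t)).
Proof.
apply: ent_mp; apply: ent_And1; exact: (ent_PA2 _ s t PA_Le).
Qed.

Lemma ent_LeI G s t u : G |- Eq (Add u s) t -> G |- Le s t.
Proof.
move=> H; apply: (@ent_mp _ (Ex (Eq (Add (Var 0) (tshift s)) (tshift t)))).
  by apply: ent_And2; exact: (ent_PA2 _ s t PA_Le).
by apply: (@ent_ExI _ _ u); rewrite /inst /= !tsubst_shift.
Qed.

Lemma ent_Le_iter G k t : G |- Le (numeral k) (iter k Succ t).
Proof. exact: (@ent_LeI _ _ _ t (ent_Add_numeral _ _ _)). Qed.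

(** From [u + S^(k+1) t = k], cancelling [k] successors leaves [S (u + t) = 0]. *)
Lemma ent_not_Le G k t A : G |- Le (iter k.+1 Succ t) (numeral k) -> G |- A.
Proof.
move/ent_LeE => H; apply: ent_BotE; apply: (ent_ExE H).
rewrite tshift_numeral /tshift tsubst_iter -/(tshift t).
apply: (@ent_Succ_neq0 _ (Add (Var 0) (tshift t))).
apply: (@ent_iter_inj _ k); rewrite -iterSr.
by apply: ent_trans (ent_hd _ _); apply/ent_sym/ent_AddS.
Qed.

(** For [m < n] the equation rewrites [m <= m] into [n <= m], which [ent_not_Le] refutes. *)
Lemma ent_numeral_neq G m n A : m != n -> G |- Eq (numeral m) (numeral n) -> G |- A.
Proof.
wlog lt : m n / m < n => [W ne H|_ H].
  case: (ltngtP m n) (ne) => // lt _; first exact: W H.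
  by apply: (W n m) => //; [rewrite eq_sym|apply: ent_sym].
apply: (@ent_not_Le _ m (numeral (n - m.+1))).
rewrite iter_numeral subnKC //; apply: (@ent_Le _ (numeral m) (numeral m)) => //.
  exact: ent_refl.
exact: (ent_Le_iter _ m Zero).
Qed.

Lemma ent_Le_numerals G m n : m <= n -> G |- Le (numeral m) (numeral n).
Proof. by move/subnKC<-; rewrite -iter_numeral; apply: ent_Le_iter. Qed.

Lemma ent_not_Le_numerals G m n A : n < m -> G |- Le (numeral m) (numeral n) -> G |- A.
Proof. by move/subnKC<-; rewrite -iter_numeral; apply: ent_not_Le. Qed.

Lemma proves_All_mono A B : proves T (All A) -> [:: A] |- B -> proves T (All B).
Proof.
move=> H HB; apply: (@ent_mp [::] (All A)) H.
apply/ent_ImpI/ent_AllI; apply: (ent_mp (ent_weak _ (ent_ImpI HB))).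
have := ent_AllE (Var 0) (ent_hd [::] (shift (All A))).
by rewrite inst_up (@subst_ext _ Var) ?subst_id // => -[].
Qed.

(** The only use of induction in [T]: the case distinction [x = 0], ...,
    [x = k - 1], [x = S^k x']. *)
Lemma proves_All_cases k A : (forall i, i < k -> proves T (inst A (numeral i))) ->
  proves T (All (subst (scons (iter k Succ (Var 0)) (fun i => Var i.+1)) A)) ->
  proves T (All A).
Proof.
elim: k A => [|k IH] A Hi H.
  by rewrite -[A]subst_id (@subst_ext Var (scons (Var 0) (fun i => Var i.+1))) // => -[].
(* The case of [k] is applied to [A(S x)]: its instance at [i] is [A(i + 1)], and at [S^k x] it
   becomes [A(S^(k+1) x)]. *)
have HS : proves T (All (subst (scons (Succ (Var 0)) (fun i => Var i.+1)) A)).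
  apply: IH => [i lt|].
    rewrite /inst subst_comp; have := Hi i.+1 lt; rewrite /inst /=.
    by rewrite (@subst_ext (scons (Succ _) _) (fun j =>
      tsubst (scons (numeral i) Var)
        (scons (Succ (Var 0)) (fun i => Var i.+1) j))) // => -[].
  rewrite subst_comp; move: H.
  by rewrite (@subst_ext (scons (iter _ _ _) _) (fun j =>
    tsubst (scons (iter k Succ (Var 0)) (fun i => Var i.+1))
      (scons (Succ (Var 0)) (fun i => Var i.+1) j))) // => -[].
(* In the induction step [A(S x)] is already a theorem, so the premise [A(x)] is simply
   discarded. *)
apply: (@ent_mp [::]); last exact:
  (proves_All_mono HS (ent_ImpI (ent_weak A (ent_hd _ _)))).
by apply: (@ent_mp [::] _ _ _ (Hi 0 _)) => //; apply/HT/pr_axiom/PA_Ind.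
Qed.

(** At [x = S^k x'] the premise reads [S^(k+1) x' <= k], which is refutable. *)
Lemma proves_AllLt_numeral k A : (forall i, i < k -> proves T (inst A (numeral i))) ->
  proves T (All (Imp (Lt (Var 0) (numeral k)) A)).
Proof.
move=> H; apply: (@proves_All_cases k) => [i /H Hi|] /=.
  exact: (@ent_ImpI [::] _ _ (ent_thm _ Hi)).
apply: pr_Gen; apply: (@ent_ImpI [::]); rewrite tsubst_numeral.
exact: (ent_not_Le _ (ent_hd _ _)).
Qed.

(** * Numeral instances, bounded quantifiers and the decision of Delta_0 formulas in [T] *)

Notation num e := (fun i => numeral (e i)).

Lemma inst_num e n A :
  inst (subst (up (num e)) A) (numeral n) = subst (num (scons n e)) A.
Proof. by rewrite inst_up; apply: subst_ext => -[]. Qed.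

Lemma tshift_num e t : tshift (tsubst (num e) t) = tsubst (num e) t.
Proof.
by rewrite /tshift tsubst_comp; apply: tsubst_ext => i; apply: tsubst_numeral.
Qed.

(** [T] equates the closed bound with the numeral of its value, which leaves finitely many
    instances. *)
Lemma proves_AllLt e t A :
  (forall i, i < teval e t -> proves T (subst (num (scons i e)) A)) ->
  proves T (subst (num e) (AllLt t A)).
Proof.
move=> H; rewrite /= tshift_up.
have := @proves_AllLt_numeral (teval e t) (subst (up (num e)) A).
move=> /(_ _)/(@proves_All_mono); apply=> [i lt|].
  by rewrite inst_num; apply: H.
apply: (@ent_ImpI [:: _]); apply: ent_mp (ent_weak _ (ent_hd _ _)) _.
apply: ent_Le (ent_hd _ _) => //; first exact: ent_refl.
by rewrite tshift_num; apply: ent_teval.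
Qed.

Lemma ent_AllLtE G e t A i : i < teval e t ->
  G |- subst (num e) (AllLt t A) -> G |- subst (num (scons i e)) A.
Proof.
move=> lt /(@ent_AllE _ _ (numeral i)) /=.
rewrite tshift_up /inst /= tsubst_shift -/(inst _ _) inst_num => H.
apply: (ent_mp H); apply: (@ent_Le _ (numeral i.+1) (numeral (teval e t))).
- exact: ent_refl.
- exact/ent_sym/ent_teval.
- exact: ent_Le_numerals.
Qed.

Lemma proves_Neg_Ex A : proves T (All (Neg A)) -> proves T (Neg (Ex A)).
Proof. by apply: pr_MP; apply/pr_logical/(ax_ExE A Bot). Qed.

(** Finite search stands in for excluded middle: it decides bounded quantifiers and later finds a
    least witness. *)
Lemma bounded_search (P Q : nat -> Prop) k : (forall i, P i \/ Q i) ->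
  (forall i, i < k -> P i) \/ exists2 i, i < k & Q i.
Proof.
move=> H; elim: k => [|k [IH|[i lt q]]]; first by left.
- case: (H k) => [p|q]; last by right; exists k.
  by left=> i; rewrite ltnS leq_eqVlt => /predU1P[->|/IH].
- by right; exists i => //; apply: ltnW.
Qed.

(** Deciding truth together with provability in one induction gives both the completeness of [T] for
    these formulas and the constructive case distinctions on [sat] used below. *)
Lemma delta0_decided A : delta0 A -> forall e,
  (sat e A /\ proves T (subst (num e) A)) \/
  (~ sat e A /\ proves T (Neg (subst (num e) A))).
Proof.
elim=> {A} [s t|s t||A B _ IA _ IB|A B _ IA _ IB|A B _ IA _ IB|t A _ IA|t A _ IA] e.
- have [Hs Ht] := (@ent_teval [::] e s, @ent_teval [::] e t).
  case: (eqVneq (teval e s) (teval e t)) => [E|ne].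
    by left; split=> //; apply: (ent_trans Hs); rewrite E; apply: ent_sym.
  right; split=> /=; first exact/eqP.
  apply: (@ent_ImpI [::]); apply: (ent_numeral_neq _ ne).
  apply: ent_trans (ent_weak _ Ht).
  exact: ent_trans (ent_sym (ent_weak _ Hs)) (ent_hd _ _).
- have [Hs Ht] := (@ent_teval [::] e s, @ent_teval [::] e t).
  case: (leqP (teval e s) (teval e t)) => lt.
    left; split=> //; apply: (ent_Le (ent_sym Hs) (ent_sym Ht)).
    exact: ent_Le_numerals.
  right; split=> /=; first by apply/negP; rewrite -ltnNge.
  apply: (@ent_ImpI [::]); apply: (ent_not_Le_numerals _ lt).
  exact: ent_Le (ent_weak _ Hs) (ent_weak _ Ht) (ent_hd _ _).
- by right; split=> //; apply: (@ent_ImpI [::]); apply: ent_hd.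
- case: (IB e) => [[b pB]|[b pB]].
    by left; split=> [_ //|]; apply: (@ent_ImpI [::]); apply: ent_weak.
  case: (IA e) => [[a pA]|[a pA]]; [right|left].
    split=> [H|]; first exact/b/H.
    apply: (@ent_ImpI [::]); apply: ent_mp (ent_thm _ pB) _.
    exact: ent_mp (ent_hd _ _) (ent_thm _ pA).
  split=> [/a //|]; apply: (@ent_ImpI [::]); apply: ent_BotE.
  exact: ent_mp (ent_thm _ pA) (ent_hd _ _).
- case: (IA e) => [[a pA]|[a pA]]; last first.
    right; split=> [[]//|]; apply: (@ent_ImpI [::]).
    exact: ent_mp (ent_thm _ pA) (ent_And1 (ent_hd _ _)).
  case: (IB e) => [[b pB]|[b pB]].
    by left; split=> //; apply: (@ent_AndI [::]).
  right; split=> [[]//|]; apply: (@ent_ImpI [::]).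
  exact: ent_mp (ent_thm _ pB) (ent_And2 (ent_hd _ _)).
- case: (IA e) => [[a pA]|[a pA]].
    by left; split; [left|apply: (@ent_Or1 [::])].
  case: (IB e) => [[b pB]|[b pB]].
    by left; split; [right|apply: (@ent_Or2 [::])].
  right; split=> [[]//|]; apply: (@ent_ImpI [::]).
  apply: ent_OrE (ent_hd _ _) _ _.
    exact: ent_mp (ent_thm _ pA) (ent_hd _ _).
  exact: ent_mp (ent_thm _ pB) (ent_hd _ _).
- case: (bounded_search (teval e t) (fun i => IA (scons i e))) => [H|[i lt [na pA]]].
    left; split; last by apply: proves_AllLt => i /H[].
    by move=> i; rewrite /= teval_tshift => /H[].
  right; split.
    by move/(_ i); rewrite /= teval_tshift => /(_ lt).
  apply: (@ent_ImpI [::]); apply: ent_mp (ent_thm _ pA) _.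
  exact: ent_AllLtE lt (ent_hd _ _).
(* The alternatives are swapped: the search now looks for a true instance. *)
- case: (bounded_search (teval e t) (fun i => proj1 (or_comm _ _) (IA (scons i e))))
    => [H|[i lt [a pA]]].
    right; split.
      by move=> [i]; rewrite /= teval_tshift => -[/H[]].
    (* A false bounded existential is refuted through the bounded universal of the negation. *)
    have: proves T (subst (num e) (AllLt t (Neg A))).
      by apply: proves_AllLt => i /H[].
    move/(@proves_All_mono _ (Neg (And _ _))) => K; apply/proves_Neg_Ex/K.
    apply: (@ent_ImpI [:: _]); apply: ent_mp (ent_And2 (ent_hd _ _)).
    exact: ent_mp (ent_weak _ (ent_hd _ _)) (ent_And1 (ent_hd _ _)).
  left; split; first by exists i; rewrite /= teval_tshift.
  apply: (@ent_ExI [::] _ (numeral i)).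
  rewrite /inst /= tshift_up tsubst_shift -/(inst _ _) inst_num.
  apply: (@ent_AndI [::]) => //.
  apply: (@ent_Le _ (numeral i.+1) (numeral (teval e t))).
  + exact: ent_refl.
  + exact/ent_sym/ent_teval.
  + exact: ent_Le_numerals.
Qed.

Lemma inst_bounded e A n :
  bounded 1 A -> inst A (numeral n) = subst (num (scons n e)) A.
Proof. by move=> b; apply: (subst_bounded b) => -[]. Qed.

Lemma bounded_inst A n : bounded 1 A -> sentence (inst A (numeral n)).
Proof. by move=> b; apply: (bounded_subst b) => -[|//] _; apply: tbounded_numeral. Qed.

Lemma ent_Ex_shift G A : G |- A -> G |- shift (Ex A).
Proof.
move=> H; apply: (@ent_ExI _ _ (Var 0)); rewrite inst_up.
by rewrite (@subst_ext _ Var) ?subst_id // => -[].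
Qed.

(** * Finite disjunctions and comparison of witnesses *)

Fixpoint disj A k : form :=
  if k is j.+1 then Or (disj A j) (inst A (numeral j)) else Bot.

Lemma ent_disj G A k i : i < k -> G |- inst A (numeral i) -> G |- disj A k.
Proof.
move=> + H; elim: k => //= k IH; rewrite ltnS leq_eqVlt => /predU1P[<-|/IH].
- exact: ent_Or2.
- exact: ent_Or1.
Qed.

Lemma sentence_disj A k : bounded 1 A -> sentence (disj A k).
Proof.
move=> b; elim: k => //= k IH.
by apply/andP; split; [exact: IH|apply: bounded_inst].
Qed.

Lemma sigma1Box_disj A k : sigma1Box A -> sigma1Box (disj A k).
Proof.
move=> s; elim: k => /= [|k IH]; first by do 3!constructor.
by apply: sigma1Box_Or IH _; apply: sigma1Box_subst.
Qed.

(** The disjunction property strips one disjunct at a time; consistency excludes reaching the empty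
    disjunction [Bot]. *)
Lemma disj_proves A k : has_sigma1Box_DP T -> ~ proves T Bot ->
  sigma1Box A -> bounded 1 A -> proves T (disj A k) ->
  exists n, proves T (inst A (numeral n)).
Proof.
move=> DP con sA bA; elim: k => //= k IH /DP[]; try by [].
- exact: sigma1Box_disj.
- exact: sigma1Box_subst.
- exact: sentence_disj.
- exact: bounded_inst.
- by exists k.
Qed.

(** A witness of [A] is split on [R] by classical logic inside [T]. *)
Lemma proves_Or_Ex A R : proves T (Ex A) ->
  proves T (Or (Ex (And A R)) (Ex (And A (Neg R)))).
Proof.
move=> H; apply: (@ent_ExE [::] _ _ H); apply: (@ent_em _ R).
- apply: (@ent_Or1 _ (shift (Ex (And A R)))); apply: ent_Ex_shift.
  by apply: ent_AndI; [apply/ent_weak/ent_hd|apply: ent_hd].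
- apply: (@ent_Or2 _ _ (shift (Ex (And A (Neg R))))); apply: ent_Ex_shift.
  by apply: ent_AndI; [apply/ent_weak/ent_hd|apply: ent_hd].
Qed.

(** For [x = S^(w+1) x'] the true instance [w] of [C] witnesses
    [ExLt (Var 0) C], so that only the values [x <= w] remain. *)
Lemma proves_disj A C e w : bounded 1 A -> delta0 C -> bounded 1 C ->
  sat (scons w e) C -> proves T (Ex (And A (Neg (ExLt (Var 0) C)))) ->
  proves T (disj A w.+1).
Proof.
move=> bA dC bC Cw; apply: (@ent_mp [::]).
apply: (@ent_mp [::]); first exact/pr_logical/ax_ExE.
have sD (s : nat -> term) : subst s (disj A w.+1) = disj A w.+1.
  exact: (subst_bounded_id (sentence_disj _ bA)).
pose R := ExLt (Var 0) C.
have sF (s : nat -> term) : subst s (Imp (And A (Neg R)) (disj A w.+1)) =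
    Imp (And (subst s A) (Neg (subst s R))) (disj A w.+1).
  by rewrite -[in RHS](sD s).
rewrite [shift _]sD; apply: (@proves_All_cases w.+1) => [i lt|].
  rewrite /inst sF; apply: (@ent_ImpI [::]).
  exact: (ent_disj lt (ent_And1 (ent_hd _ _))).
apply: pr_Gen; rewrite sF; apply: (@ent_ImpI [::]); apply: ent_BotE.
apply: (ent_mp (ent_And2 (ent_hd _ _))).
apply: (@ent_ExI _ _ (numeral w)); apply: ent_AndI; fold subst.
  rewrite /= tsubst_shift; apply: (ent_Le_iter _ w.+1).
rewrite -/subst -/(inst _ _) (@subst_bounded_id 1 (up _) C) //; last by case.
rewrite (inst_bounded e) //; apply: ent_thm.
by case: (delta0_decided dC (scons w e)) => [[]|[/(_ Cw)]].
Qed.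

(** For [x < z], [A(x)] is false and hence refuted. For [x = S^z x'], the number [z] lies below
    [S x], so the provable [B(z)] contradicts the bounded conjunct. *)
Lemma proves_All_Neg A B e z : delta0 A -> delta0 B ->
  bounded 1 A -> bounded 1 B ->
  sat (scons z e) B -> (forall y, y < z -> ~ sat (scons y e) A) ->
  proves T (All (Neg (And A (AllLt (Succ (Var 0)) (Neg B))))).
Proof.
move=> dA dB bA bB Bz nA; apply: (@proves_All_cases z) => [i lt|].
  apply: (@ent_ImpI [::]).
  apply: ent_mp _ (ent_And1 (ent_hd _ _)); apply: ent_thm.
  change (proves T (Neg (inst A (numeral i)))); rewrite (inst_bounded e) //.
  by case: (delta0_decided dA (scons i e)) => [[/(nA _ lt)]|[]].
apply: pr_Gen; apply: (@ent_ImpI [::]).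
rewrite -/(subst _ (AllLt _ _)) [subst _ (AllLt _ _)]/=.
rewrite (@subst_bounded_id 1 (up _) B) //; last by case.
set hyp := [:: _]; have := ent_AllE (numeral z) (ent_And2 (ent_hd _ _ : hyp |- _)).
rewrite /inst /= tsubst_shift -/(inst _ _) (inst_bounded e) // => H.
apply: ent_mp (ent_mp H (ent_Le_iter _ z.+1 _)) _; apply: ent_thm.
by case: (delta0_decided dB (scons z e)) => [[]|[/(_ Bz)]].
Qed.

Lemma proves_Neg_ExAnd A C : proves T (All (Neg C)) ->
  proves T (Neg (Ex (And A (ExLt (Var 0) C)))).
Proof.
move=> H; have: proves T (Neg (ExLt (Var 0) C)).
  apply: proves_Neg_Ex; apply: (proves_All_mono H); apply: (@ent_ImpI [:: _]).
  exact: ent_mp (ent_weak _ (ent_hd _ _)) (ent_And2 (ent_hd _ _)).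
move=> K; apply/proves_Neg_Ex/pr_Gen; apply: (@ent_ImpI [::]).
exact: ent_mp (ent_thm _ K) (ent_And2 (ent_hd _ _)).
Qed.

(** A substitute for [inst A (numeral n)] whose code is given by a term in
    [n] and the code of [A]. *)
Definition at_numeral A n : form := Ex (And (Eq (Var 0) (numeral n)) A).

Lemma ent_at_numeral G A n :
  G |- inst A (numeral n) -> G |- at_numeral A n.
Proof.
move=> H; apply: (@ent_ExI _ _ (numeral n)); apply: ent_AndI H.
by fold tsubst; rewrite tsubst_numeral; apply: ent_refl.
Qed.

Lemma at_numeral_proves A n :
  proves T (at_numeral A n) -> proves T (inst A (numeral n)).
Proof.
move/(@ent_ExE [::]); apply.
(* The rewritten formula is [A] at [Var 0] and the shift of [inst A (numeral n)] at the numeral. *)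
have := @ent_rew (subst (up (fun i => Var i.+1)) A)
  [:: And (Eq (Var 0) (numeral n)) A] (Var 0) (numeral n) (ent_And1 (ent_hd _ _)).
rewrite !inst_up (@subst_ext (scons (Var 0) _) Var) ?subst_id => [|[]//].
rewrite /shift /inst subst_comp (@subst_ext (fun i => tsubst _ _)
  (scons (numeral n) (fun i => Var i.+1))); last first.
  by case=> //=; rewrite tsubst_numeral.
by apply; apply: ent_And2 (ent_hd _ _).
Qed.

(** * Truth of translations, completeness and the existence property *)

Section ProvabilityPredicate.

Variable Pr : form.
Hypothesis HPr : provability_predicate T Pr.

Lemma Pr_arithmetical : arithmetical Pr.
Proof. by case: HPr => /sigma1_arithmetical. Qed.

(** As only index 0 is free in [Pr], the numeral of the code can be traded for its value in any
    environment. *)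
Lemma sat_Pr e A : sentence A -> (sat (scons (code A) e) Pr <-> proves T A).
Proof.
case: HPr => s1 b1 H sA; have K e' := sat_subst e'
  (scons (numeral (code A)) Var) Pr_arithmetical.
have E e' i : i < 1 ->
    scons (code A) e i = teval e' (scons (numeral (code A)) Var i).
  by case: i => //= _; rewrite teval_numeral.
split=> [h|/(H _ sA)/(_ e)/K h]; last by case: (sat_bounded b1 (E e)) => _; apply.
by apply/(H _ sA) => e'; apply/K; case: (sat_bounded b1 (E e')) => + _; apply.
Qed.

(** By [dot_spec] the translated box speaks of the code of the numeral instance, which is a
    sentence. *)
Lemma sat_rho_Box e A :
  sat e (rho Pr (Box A)) <-> proves T (subst (num e) (Box A)).
Proof.
rewrite /= /inst; apply: iff_trans (sat_subst _ _ Pr_arithmetical) _.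
apply: iff_trans (@sat_Pr e (Box (subst (num e) A)) _).
  by rewrite -[Box _]/(subst (num e) (Box A)) -dot_spec; apply: sat_ext => -[].
by apply: bounded_subst_all => i; apply: tbounded_numeral.
Qed.

Lemma sat_rho_AllLt e t A : sat e (rho Pr (AllLt t A)) <->
  forall i, i < teval e t -> sat (scons i e) (rho Pr A).
Proof. by split=> H i; move: (H i); rewrite /= teval_tshift. Qed.

Lemma proves_Ex e n A : proves T (subst (num (scons n e)) A) ->
  proves T (subst (num e) (Ex A)).
Proof.
by move=> H; apply: (@ent_ExI [::] _ (numeral n)); rewrite inst_num.
Qed.

(** Stating this for numeral instances lets the induction pass under quantifiers. *)
Lemma sigma1Box_complete A : sigma1Box A -> forall e,
  sat e (rho Pr A) -> proves T (subst (num e) A).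
Proof.
elim=> {A} [A s1A|A|A B _ IA _ IB|A B _ IA _ IB|A _ IA|t A _ IA] e.
- elim: s1A e => {A} [A d|A _ IA] e.
    rewrite rho_arithmetical ?delta0_arithmetical //.
    by case: (delta0_decided d e) => -[].
  by case=> n /IA; apply: proves_Ex.
- by move/sat_rho_Box.
- by case=> /IA a /IB b; apply: (@ent_AndI [::]).
- by case=> [/IA a|/IB b]; [apply: (@ent_Or1 [::])|apply: (@ent_Or2 [::])].
- by case=> n /IA; apply: proves_Ex.
- by move/sat_rho_AllLt=> H; apply: proves_AllLt => i /H/IA.
Qed.

Lemma sound_EP : weakly_sigma1Box_sound T Pr -> has_sigma1Box_EP T.
Proof.
move=> S A sA bA HA; have [n] := S _ (sigma1Box_Ex sA) bA HA (fun=> 0).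
move/(sigma1Box_complete sA) => H; exists n.
by rewrite (inst_bounded (fun=> 0)).
Qed.

(** The arithmetized [at_numeral]. The innermost pair of [t] with [npair 1 0], which stands for
    [Zero], is the code of the numeral of the value of [t]. *)
Definition tat_numeral (t c : term) : term :=
  tpair (numeral 7) (tpair (numeral 4) (tpair
    (tpair (numeral 0) (tpair (numeral (tcode 0 (Var 0)))
      (tpair t (numeral (npair 1 0))))) c)).

Lemma teval_tpair e s t : teval e (tpair s t) = npair (teval e s) (teval e t).
Proof. by []. Qed.

Lemma tcode_numeral k n : tcode k (numeral n) = npair (k + n) (npair 1 0).
Proof. by elim: n k => [|n IH] k /=; rewrite ?addn0 // IH addSnnS. Qed.

Lemma teval_tat_numeral e t c A : teval e c = code A ->
  teval e (tat_numeral t c) = code (at_numeral A (teval e t)).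
Proof.
move=> E; rewrite /tat_numeral !teval_tpair !teval_numeral E.
by rewrite -[code (at_numeral _ _)]/(npair 7 (npair 4 (npair (npair 0 (npair _
  (tcode 0 (numeral (teval e t))))) (code A)))) tcode_numeral.
Qed.

(** * From the disjunction property to the existence property and soundness *)

Section DisjunctionProperty.

Hypothesis DP : has_sigma1Box_DP T.
Hypothesis con : ~ proves T Bot.

(** [a] and [b] say that index 0 witnesses the provability of [beta] and of
    [alpha].  The self-reference goes through [at_numeral], with the code of
    [R0] as the numeral. *)
Lemma sigma1Box_DP_EP A : sigma1Box A -> bounded 1 A -> proves T (Ex A) ->
  exists n, proves T (inst A (numeral n)).
Proof.
move=> sA bA HA; have [s1 b1 _] := HPr; have [W dW satW] := sigma1_witness s1.
(* If [t] has the value [n] chosen below, these terms evaluate to the codes of [alpha] and [beta];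
   the tags 7, 4 and 3 are those of [Ex], [And] and [Imp]. *)
pose calpha t := tat_numeral t
  (tpair (numeral 7) (tpair (numeral 4) (tpair (numeral (code A)) t))).
pose cbeta t := tat_numeral t
  (tpair (numeral 7) (tpair (numeral 4) (tpair (numeral (code A))
    (tpair (numeral 3) (tpair t (numeral (code Bot))))))).
(* Index 0 is the witness and index 1 of [W] receives the code; the remaining indices get the
   default [Zero], in accordance with [e0]. *)
pose wit (c : term) := subst (scons (Var 0) (scons c (fun=> Zero))) W.
(* The parameter, index 1, stands for the code of [R0]. The bound [Succ (Var 0)] includes the
   witness itself, so a tie counts for [alpha]. *)
pose C0 := And (wit (cbeta (Var 1)))
  (AllLt (Succ (Var 0)) (Neg (wit (calpha (Var 2))))).
(* Here index 0 is the variable of [A] and index 1 the parameter, seen as [Var 2] under the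
   quantifier. *)
pose R0 := ExLt (Var 0) (subst (scons (Var 0) (fun=> Var 2)) C0).
(* Keeping [n] abstract prevents simplification from unfolding this code. *)
have [n nE] : exists n, n = code R0 by exists (code R0).
pose alpha := at_numeral (Ex (And A R0)) n.
pose beta := at_numeral (Ex (And A (Neg R0))) n.
pose s := scons (Var 0) (fun=> numeral n).
pose a := subst s (wit (cbeta (Var 1))).
pose b := subst (up s) (wit (calpha (Var 2))).
pose C := And a (AllLt (Succ (Var 0)) (Neg b)).
have dwit c : delta0 (wit c) by apply: delta0_subst.
have [da db] : delta0 a /\ delta0 b by split; apply: delta0_subst.
have dC0 : delta0 C0.
  by apply: delta0_And => //; apply/delta0_AllLt/delta0_Imp => //; constructor.
have dR0 : delta0 R0 by apply/delta0_ExLt/delta0_subst.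
have dC : delta0 C.
  by apply: delta0_And => //; apply/delta0_AllLt/delta0_Imp => //; constructor.
have ba : bounded 1 a.
  by apply: bounded_subst_all => -[|i] //=; apply: tbounded_numeral.
have bb : bounded 1 b.
  rewrite /b subst_comp; apply: bounded_subst_all => -[|[|i]] //=.
  by rewrite tshift_numeral !tsubst_numeral !tbounded_numeral.
(* Filling the parameter with the numeral of [n] closes the self-reference. *)
have instR0 : subst (up (scons (numeral n) Var)) R0 = ExLt (Var 0) C.
  rewrite -[C]/(subst s C0) -[LHS]/(ExLt (Var 0) (subst
    (up (up (scons (numeral n) Var))) (subst (scons (Var 0) (fun=> Var 2)) C0))).
  congr ExLt; rewrite subst_comp; apply: subst_ext.
  by case=> //= i; rewrite !tshift_numeral.
have instA : subst (up (scons (numeral n) Var)) A = A.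
  by apply: subst_bounded_id bA _; case.
have instalpha : inst (Ex (And A R0)) (numeral n) = Ex (And A (ExLt (Var 0) C)).
  by rewrite -[inst _ _]/(Ex (And (subst _ A) (subst _ R0))) instR0 instA.
have instbeta : inst (Ex (And A (Neg R0))) (numeral n) =
    Ex (And A (Neg (ExLt (Var 0) C))).
  by rewrite -[inst _ _]/(Ex (And (subst _ A) (Neg (subst _ R0)))) instR0 instA.
have mono F : bounded 1 F -> bounded 2 F.
  by move=> bF; rewrite -[F]subst_id; apply: (bounded_subst bF) => -[].
have bA2 := mono A bA.
have bR0 : bounded 2 R0.
  have H : bounded 3 (subst (scons (Var 0) (fun=> Var 2)) C0).
    by apply: bounded_subst_all => -[].
  exact: H.
have sentalpha : sentence alpha.
  apply/andP; split; first exact: tbounded_numeral.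
  by change (bounded 2 A && bounded 2 R0); rewrite bA2 bR0.
have sentbeta : sentence beta.
  apply/andP; split; first exact: tbounded_numeral.
  by change (bounded 2 A && (bounded 2 R0 && true)); rewrite bA2 bR0.
have s1B F : delta0 F -> sigma1Box F by do 2!constructor.
have salpha : sigma1Box alpha.
  apply/sigma1Box_Ex/sigma1Box_And/sigma1Box_Ex/sigma1Box_And => //;
  by apply: s1B => //; constructor.
have sbeta : sigma1Box beta.
  apply/sigma1Box_Ex/sigma1Box_And/sigma1Box_Ex/sigma1Box_And => //;
  by apply: s1B => //; constructor=> //; constructor.
pose e0 : nat -> nat := fun=> 0.
(* The code term must have the same value for every witness [z]; then [satW] turns witnesses into
   provability. *)
have satwit (r : nat -> term) c F : r 0 = Var 0 -> sentence F ->
    (forall z, teval (fun i => teval (scons z e0) (r i)) c = code F) ->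
    (exists z, sat (scons z e0) (subst r (wit c))) <-> proves T F.
  move=> r0 sF E; apply: iff_trans (sat_Pr e0 sF); apply: iff_trans (iff_sym (satW _)).
  have K z : sat (scons z e0) (subst r (wit c)) <->
      sat (scons z (scons (code F) e0)) W.
    apply: iff_trans (sat_subst _ _ (delta0_arithmetical (dwit c))) _.
    apply: iff_trans (sat_subst _ _ (delta0_arithmetical dW)) _.
    by apply: sat_ext => -[|[|i]] //=; rewrite ?r0 ?E.
  by split=> -[z /K H]; exists z.
have sata : (exists z, sat (scons z e0) a) <-> proves T beta.
  apply: satwit => // z; rewrite (@teval_tat_numeral _ _ _ (Ex (And A (Neg R0)))).
    by rewrite /= teval_numeral.
  by rewrite !teval_tpair !teval_numeral [teval _ (Var 1)]/= teval_numeral nE.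
have satb : (exists z, sat (scons z e0) b) <-> proves T alpha.
  apply: satwit => // z; rewrite (@teval_tat_numeral _ _ _ (Ex (And A R0))).
    by rewrite /= tshift_numeral teval_numeral.
  by rewrite !teval_tpair !teval_numeral [teval _ (Var 2)]/= tshift_numeral
    teval_numeral nE.
have : exists z, sat (scons z e0) a \/ sat (scons z e0) b.
  have /DP[] // : proves T (Or alpha beta).
  - apply: (@ent_OrE [::] _ _ _ (proves_Or_Ex (ExLt (Var 0) C) HA)).
      by apply/(@ent_Or1 [:: _])/ent_at_numeral; rewrite instalpha; apply: ent_hd.
    by apply/(@ent_Or2 [:: _])/ent_at_numeral; rewrite instbeta; apply: ent_hd.
  - by case/satb=> z; exists z; right.
  - by case/sata=> z; exists z; left.
case=> z; elim/ltn_ind: z => z IH ab.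
(* Decidability of [a] and [b] allows a descent to the least number satisfying either. *)
have dec y : (~ sat (scons y e0) a /\ ~ sat (scons y e0) b) \/
    (sat (scons y e0) a \/ sat (scons y e0) b).
  case: (delta0_decided da (scons y e0)) => -[ay _]; first by right; left.
  by case: (delta0_decided db (scons y e0)) => -[bY _]; [right; right|left].
case: (bounded_search z dec) => [nab|[y lt /(IH _ lt)]] //.
(* If [b] holds at the least [z], then [alpha] is both provable and refutable. *)
case: (delta0_decided db (scons z e0)) => -[bz _].
  case: con; have palpha : proves T alpha by apply/satb; exists z.
  have := at_numeral_proves palpha; rewrite instalpha.
  apply: pr_MP; apply: proves_Neg_ExAnd; apply: (proves_All_Neg da db ba bb bz).
  by move=> y /nab[].
case: ab => // az; have pbeta : proves T beta by apply/sata; exists z.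
have := at_numeral_proves pbeta; rewrite instbeta => H.
apply: (@disj_proves A z.+1) => //; apply: (@proves_disj _ C e0 z) => //.
  apply/andP; split=> //; change (bounded 2 b && true).
  by rewrite mono.
(* It remains that [b] fails up to [z]: at [z] by the case at hand, below it by minimality. *)
split=> // y lt; rewrite /= ltnS in lt.
have satbE : sat (scons y (scons z e0)) b <-> sat (scons y e0) b.
  by apply: (sat_bounded bb) => -[].
move/satbE; move: lt; rewrite leq_eqVlt => /predU1P[->|/nab[]] //.
Qed.


Lemma DP_sound : weakly_sigma1Box_sound T Pr.
Proof.
have gen A : sigma1Box A -> forall e,
    proves T (subst (num e) A) -> sat e (rho Pr A).
  (* The existential step is shared by the inductions on [sigma1] and on [sigma1Box]. *)
  have caseEx B e : sigma1Box B ->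
      (forall e', proves T (subst (num e') B) -> sat e' (rho Pr B)) ->
      proves T (subst (num e) (Ex B)) -> sat e (rho Pr (Ex B)).
    move=> sB IB /sigma1Box_DP_EP[||n].
    - exact: sigma1Box_subst.
    - by apply: bounded_subst_all => -[|i] //=; rewrite tshift_numeral tbounded_numeral.
    - by rewrite inst_num => /IB; exists n.
  have sent B e : sentence (subst (num e) B).
    by apply: bounded_subst_all => i; apply: tbounded_numeral.
  elim=> {A} [A s1A|A|A B _ IA _ IB|A B sA IA sB IB|A sA IA|t A _ IA] e.
  - elim: s1A e => {A} [A d|A s1A IA] e.
      rewrite rho_arithmetical ?delta0_arithmetical //.
      (* A false Delta_0 theorem would also be refutable, against consistency. *)
      case: (delta0_decided d e) => -[] // _ nA pA.
      by case: con; apply: pr_MP nA pA.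
    by apply: caseEx => //; apply: sigma1Box_sigma1.
  - by move/sat_rho_Box.
  - move=> H; split; [apply: IA|apply: IB].
    + exact: (@ent_And1 [::] _ _ H).
    + exact: (@ent_And2 [::] _ _ H).
  - move/DP=> [] //; try exact: sigma1Box_subst.
    + by left; apply: IA.
    + by right; apply: IB.
  - exact: caseEx.
  - by move=> H; apply/sat_rho_AllLt => i lt; apply/IA/(@ent_AllLtE [::] _ _ _ _ lt).
move=> A sA bA HA e; apply: gen => //.
by rewrite (@subst_bounded_id 0).
Qed.

End DisjunctionProperty.
End ProvabilityPredicate.
End Deduction.

Theorem theorem6p19 (T : theory) (Pr : form)
    (HTre : re_theory T) (HText : extends T PABox)
    (HPr : provability_predicate T Pr) :
  (extends T PAK -> ~ proves T (Box Bot) -> has_sigma1Box_DP T ->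
     weakly_sigma1Box_sound T Pr) /\
  (weakly_sigma1Box_sound T Pr -> has_sigma1Box_EP T).
Proof.
split=> [_ nBox DP|]; last exact: sound_EP.
(* Necessitation turns a proof of [Bot] into one of [Box Bot], which gives consistency. *)
by apply: DP_sound => // /pr_Nec.
Qed.
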